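(* Let $\Omega\subset\mathbb{R}^2$ be a polygon such that there exists a point $\mathbf{p}\in\Omega$ which is a common zero of all orthogonal polynomials $P_{2k-1,j}$, $j=0,\dots,2k-1$, for all $k=1,2,\dots$. For any polynomial $P_n$ of degree $n$ with $2d-1\le n\le 2d$, $d\ge 1$, write $$P_n(x,y)=\sum_{j=0}^{2d-1}q_j(x,y)P_{2d-1,j}(x,y)+\sum_{j=0}^{2d-3}\hat q_j(x,y)P_{2d-3,j}(x,y)+\cdots+\sum_{j=0}^{1}\tilde q_j(x,y)P_{1,j}(x,y)+R,$$ based on orthogonal polynomials of odd degree, where the residual $R$ is a constant and the quotients $q_j,\hat q_j,\dots,\tilde q_j$ are linear polynomials. If $\tilde q_j$ is a constant function for $j=0$ and $j=1$, then $$\int_\Omega P_n(x,y)\,dx\,dy=P_n(\mathbf{p})A_\Omega,$$ where $A_\Omega$ is the area of $\Omega$. If the $\tilde q_j$ are linear polynomials $\tilde q_j=a_jx+b_jy+c_j$, $j=0,1$, then $$\int_\Omega P_n(x,y)\,dx\,dy=P_n(\mathbf{p})A_\Omega+\sum_{j=0}^1(a_j\alpha_j+b_j\beta_j),$$ where $\alpha_j=\int_\Omega xP_{1,j}(x,y)\,dx\,dy$ and $\beta_j=\int_\Omega yP_{1,j}(x,y)\,dx\,dy$ for $j=0,1$.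
   Context: $\mathbb{P}_m$ is the space of real bivariate polynomials of total degree $\le m$. A polygon is a bounded polygonal domain in $\mathbb{R}^2$ with positive area. For each $m\ge 1$, $P_{m,0},\dots,P_{m,m}$ is an orthogonal basis, with respect to the inner product $\int_\Omega fg\,dx\,dy$, of $\mathbb{P}_m\ominus\mathbb{P}_{m-1}$, the orthogonal complement of $\mathbb{P}_{m-1}$ in $\mathbb{P}_m$. ''Linear polynomial'' means a real bivariate polynomial of total degree at most $1$. The sums in the expansion run over the odd degrees $2d-1,2d-3,\dots,3,1$. *)

(* Defs.v *)
From HB Require Import structures.
From mathcomp Require Import all_boot all_order all_algebra.
From mathcomp Require Import all_classical all_reals all_analysis.
(* mpoly's notations clash with those of MathComp-Analysis, hence the
   filtered import and the explicit names below. *)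
From mathcomp Require Import -(notations) mpoly.
Import Order.TTheory GRing.Theory Num.Theory.
Import numFieldNormedType.Exports.

Set Implicit Arguments.
Unset Strict Implicit.
Unset Printing Implicit Defensive.

Local Open Scope classical_set_scope.
Local Open Scope ring_scope.

Notation bipoly R := (mpoly 2 R).

Definition Xvar (R : realType) : bipoly R := mpolyX R (mnm1 (ord0 : 'I_2)).
Definition Yvar (R : realType) : bipoly R := mpolyX R (mnm1 (ord_max : 'I_2)).

Definition peval (R : realType) (f : bipoly R) (z : R * R) : R :=
  meval (fun i : 'I_2 => if i == ord0 then z.1 else z.2) f.

(* [mmeasure mdeg f] is [msize f]: one plus the total degree, and 0 if f = 0. *)
Definition Pspace (R : realType) (m : nat) : set (bipoly R) :=
  [set f | (mmeasure mdeg f <= m.+1)%N].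

Notation leb2 R := (@lebesgue_measure R \x @lebesgue_measure R)%E.

Definition intp (R : realType) (Omega : set (R * R)) (f : bipoly R) : R :=
  Rintegral (leb2 R) Omega (peval f).

Definition area (R : realType) (Omega : set (R * R)) : R :=
  fine (leb2 R Omega).

Definition segment (R : realType) (e : (R * R) * (R * R)) : set (R * R) :=
  [set z | exists2 t : R, 0 <= t <= 1 &
    z = ((1 - t) * e.1.1 + t * e.2.1, (1 - t) * e.1.2 + t * e.2.2)].

Definition polygonal_domain (R : realType) (U : set (R * R)) : Prop :=
  [/\ open U, connected U, bounded_set U
    & exists s : seq ((R * R) * (R * R)),
        closure U `\` interior U = \bigcup_(e in [set` s]) segment e].

(* Both the open and the closed convention are allowed: a polygon is a
   polygonal domain, with or without its boundary. *)
Definition polygon (R : realType) (Omega : set (R * R)) : Prop :=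
  (exists2 U : set (R * R), polygonal_domain U & Omega = U \/ Omega = closure U)
  /\ (0 < leb2 R Omega)%E.

Definition orthocompl (R : realType) (Omega : set (R * R)) (m : nat) :
    set (bipoly R) :=
  [set f | Pspace m f /\
    forall g : bipoly R, Pspace m.-1 g -> intp Omega (f * g) = 0].

Definition orthogonal_basis (R : realType) (Omega : set (R * R)) (m : nat)
    (B : 'I_m.+1 -> bipoly R) : Prop :=
  [/\ forall j, orthocompl Omega m (B j),
      forall i j, i != j -> intp Omega (B i * B j) = 0
    & forall f, orthocompl Omega m f ->
        exists! c : 'rV[R]_m.+1, f = \sum_(j < m.+1) c ord0 j *: B j].

(* q k j is the quotient of P_{2k+1,j}; hence the quotients of P_{1,0} and
   P_{1,1} are q 0 0 and q 0 1.  The values q k j with k >= d are unused. *)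
Definition odd_expansion (R : realType) (P : forall m : nat, 'I_m.+1 -> bipoly R)
    (d : nat) (f : bipoly R) (q : forall k : nat, 'I_(k.*2.+1).+1 -> bipoly R)
    (r : R) : Prop :=
  (forall k (j : 'I_(k.*2.+1).+1), (k < d)%N -> Pspace 1 (q k j)) /\
  f = \sum_(k < d) \sum_(j < (k.*2.+1).+1) q k j * P k.*2.+1 j + mpolyC 2 r.

(* Main.v *)
Require Import Defs.
From HB Require Import structures.
From mathcomp Require Import all_boot all_order all_algebra.
From mathcomp Require Import all_classical all_reals all_analysis.
From mathcomp Require Import -(notations) mpoly.
From mathcomp Require Import measurable_realfun ring lra.
Import Order.TTheory GRing.Theory Num.Theory.
Import numFieldNormedType.Exports.
Set Implicit Arguments.
Unset Strict Implicit.
Unset Printing Implicit Defensive.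
Local Open Scope classical_set_scope.
Local Open Scope ring_scope.

(** The expansion is a repeated division, and only its last stage, by [P 1 0]
    and [P 1 1], leaves a trace in the integral.

    Integration.  A product [q k j * P k.*2.+1 j] with [k >= 1] integrates to
    zero, since the linear factor has degree at most [k.*2] and the other one is
    orthogonal to that whole space.  For [k = 0] the same argument only kills
    the constant part of the quotient, which leaves the moments of [P 1 j]
    against [x] and [y].  The residual contributes [r * area Omega], and [r] is
    the value of the polynomial at [p] because every other term vanishes there
    ([intp_odd_expansion], [peval_odd_expansion]).

    Existence.  A polynomial of degree at most [m.+1] is [X * f1 + Y * f2 + c]
    with [f1] and [f2] of degree at most [m] ([Pspace_split]).  Modulo
    polynomials of degree below [m], each [fi] is a combination of the degree-[m]
    orthogonal polynomials, so dividing by these with linear quotients lowers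
    the degree bound from [m.+1] to [m.-1] ([division_step]); iterating through
    [m = 2d-1, ..., 3, 1] ends at a constant ([odd_expansion_exists]).

    The congruence modulo lower degree is an orthogonal projection onto
    [Pspace m.-1] ([orthogonal_basis_decomposition]), which exists because the
    form is symmetric and positive semidefinite ([psd_projection]).  The
    analytic input is thus the linearity of the integral on polynomials, which
    rests on a polygon being measurable and bounded, and its positivity on
    squares. *)

(** * Integrals of polynomials over a polygon *)

Definition rat_box (R : realType) (c : (rat * rat) * (rat * rat)) : set (R * R) :=
  `]ratr c.1.1, ratr c.1.2[ `*` `]ratr c.2.1, ratr c.2.2[.

Lemma rat_itv_nbhs (R : realType) (x e : R) : 0 < e ->
  exists q : rat * rat,
    ratr q.1 < x < ratr q.2 /\ `]ratr q.1, ratr q.2[ `<=` ball x e.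
Proof.
move=> e0.
have [a] := @rat_in_itvoo R (x - e) x ltac:(lra); rewrite in_itv /= => /andP[a1 a2].
have [b] := @rat_in_itvoo R x (x + e) ltac:(lra); rewrite in_itv /= => /andP[b1 b2].
exists (a, b); split; first by rewrite /= a2 b1.
move=> y /=; rewrite in_itv /= => /andP[ya yb].
by rewrite /ball /= ltr_distlC; apply/andP; split; lra.
Qed.

(** The product sigma-algebra is generated by rectangles only; the plane being
    second countable, an open set is the union of the countably many rational
    boxes it contains. *)
Lemma open_prod_measurable (R : realType) (U : set (R * R)) :
  open U -> measurable U.
Proof.
move=> oU.
have -> : U = \bigcup_(c in [set c | @rat_box R c `<=` U]) @rat_box R c.
  apply/seteqP; split=> [[x y] Uxy|z [c cU cz]]; last exact: cU.
  have /nbhs_ballP[e /= e0 eU] : nbhs (x, y) U by exact: open_nbhs_nbhs.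
  have [c [cx cxe]] := rat_itv_nbhs x e0.
  have [d [dy dye]] := rat_itv_nbhs y e0.
  exists (c, d).
    move=> [u v] [/= uc vd]; apply: eU; split=> /=; [exact: cxe|exact: dye].
  by split; rewrite /= in_itv.
rewrite bigcup_mkcond; apply: countable_bigcupT_measurable => [|c].
  exact: countableP.
case: ifP => _; last exact: measurable0.
by apply: measurableX; exact: measurable_itv.
Qed.

Lemma bounded_set_square (R : realType) (U : set (R * R)) :
  bounded_set U -> exists M : R,
    U `<=` [set z | `|z.1| <= M /\ `|z.2| <= M].
Proof.
move=> /pinfty_ex_gt0 [M _ UM]; exists M => z /UM.
by rewrite /= prod_normE ge_max => /andP[].
Qed.

Lemma polygon_measurable (R : realType) (Omega : set (R * R)) :
  polygon Omega -> measurable Omega.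
Proof.
move=> [[U [oU _ _ _] [->|->]] _]; first exact: open_prod_measurable.
rewrite -(setCK (closure U)); apply: measurableC; apply: open_prod_measurable.
by apply: closed_openC; exact: closed_closure.
Qed.

Lemma polygon_bounded (R : realType) (Omega : set (R * R)) :
  polygon Omega -> exists M : R,
    Omega `<=` [set z | `|z.1| <= M /\ `|z.2| <= M].
Proof.
move=> [[U [_ _ /bounded_set_square[M UM] _] OU] _]; exists M.
have cM : closed [set z : R * R | `|z.1| <= M /\ `|z.2| <= M].
  apply: closedI; apply: (@closed_comp _ _ _ [set x : R | x <= M]) => [z _|].
  - by apply: continuous_comp; [exact: cvg_fst|exact: norm_continuous].
  - exact: closed_le.
  - by apply: continuous_comp; [exact: cvg_snd|exact: norm_continuous].
  - exact: closed_le.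
case: OU => ->; first exact: UM.
by rewrite ((closure_id _).1 cM); exact: closure_subset.
Qed.

Lemma bounded_lebesgue2_fin (R : realType) (Omega : set (R * R)) (M : R) :
  measurable Omega -> Omega `<=` [set z | `|z.1| <= M /\ `|z.2| <= M] ->
  (leb2 R Omega < +oo)%E.
Proof.
move=> mO OM.
pose Q : set (R * R) := `[- M, M]%classic `*` `[- M, M]%classic.
have mI : measurable (`[- M, M]%classic : set R) by exact: measurable_itv.
have mQ : measurable Q by exact: measurableX.
apply: (@le_lt_trans _ _ (leb2 R Q)).
  apply: le_measure; rewrite ?inE// => z /OM [z1 z2].
  by split; rewrite /= in_itv /= -ler_norml.
rewrite product_measure1E//= lebesgue_measure_itv /=.
by case: ifP => _; rewrite ?mule0// -!EFinB -EFinM ltry.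
Qed.

Lemma peval_monomial (R : realType) (m : multinom 2) (z : R * R) :
  peval (mpolyX R m) z = z.1 ^+ m ord0 * z.2 ^+ m ord_max.
Proof.
rewrite /peval mevalX big_ord_recl big_ord1 /=.
by congr (_ * _ ^+ m _); apply/val_inj.
Qed.

Lemma monomial_integrable (R : realType) (Omega : set (R * R)) (m : multinom 2) :
  polygon Omega ->
  (leb2 R).-integrable Omega (EFin \o peval (mpolyX R m)).
Proof.
move=> pO; have mO := polygon_measurable pO; have [M OM] := polygon_bounded pO.
have -> : peval (mpolyX R m) = fun z => z.1 ^+ m ord0 * z.2 ^+ m ord_max.
  by apply/funext => z; exact: peval_monomial.
apply: measurable_bounded_integrable => //; first exact: bounded_lebesgue2_fin OM.
  apply: measurable_funM; apply: measurable_funX.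
    by apply: measurable_funTS; exact: measurable_fst.
  by apply: measurable_funTS; exact: measurable_snd.
exists (M ^+ m ord0 * M ^+ m ord_max); split; first exact: num_real.
move=> B /ltW MB z /OM [z1 z2] /=; apply: le_trans MB.
by rewrite normrM !normrX ler_pM ?exprn_ge0 ?lerXn2r ?nnegrE// (le_trans _ z1).
Qed.

Lemma peval_integrable (R : realType) (Omega : set (R * R)) (f : bipoly R) :
  polygon Omega -> (leb2 R).-integrable Omega (EFin \o peval f).
Proof.
move=> pO; have mO := polygon_measurable pO.
rewrite (_ : EFin \o peval f = fun z =>
    (\sum_(m <- msupp f) ((mcoeff m f)%:E * (peval (mpolyX R m) z)%:E))%E);
  last first.
  apply/funext => z; under eq_bigr do rewrite -EFinM.
  rewrite sumEFin /=; congr EFin; rewrite /peval [in LHS](mpolyE f).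
  by rewrite (raddf_sum (meval _)); apply: eq_bigr => m _; rewrite /= mevalZ.
apply: integrable_sum => // m _.
by apply: integrableZl => //; exact: monomial_integrable.
Qed.

Lemma intpD (R : realType) (Omega : set (R * R)) (f g : bipoly R) :
  polygon Omega -> intp Omega (f + g) = intp Omega f + intp Omega g.
Proof.
move=> pO; rewrite /intp -RintegralD//; first last.
- exact: peval_integrable.
- exact: peval_integrable.
- exact: polygon_measurable.
by congr Rintegral; apply/funext => z; rewrite /peval mevalD.
Qed.

Lemma intpZ (R : realType) (Omega : set (R * R)) (c : R) (f : bipoly R) :
  polygon Omega -> intp Omega (c *: f) = c * intp Omega f.
Proof.
move=> pO; rewrite /intp -RintegralZl//; first last.
- exact: peval_integrable.
- exact: polygon_measurable.
by congr Rintegral; apply/funext => z; rewrite /peval mevalZ.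
Qed.

Lemma intp_sqr_ge0 (R : realType) (Omega : set (R * R)) (f : bipoly R) :
  0 <= intp Omega (f * f).
Proof.
by apply: Rintegral_ge0 => z _; rewrite /peval mevalM -expr2 sqr_ge0.
Qed.

Lemma intpC (R : realType) (Omega : set (R * R)) (c : R) :
  polygon Omega -> intp Omega (mpolyC 2 c) = c * area Omega.
Proof.
move=> pO; rewrite /intp /area.
rewrite (_ : peval (mpolyC 2 c) = cst c); last first.
  by apply/funext => z; rewrite /peval mevalC.
by rewrite Rintegral_cst//; exact: polygon_measurable.
Qed.

Lemma intp_sum (R : realType) (Omega : set (R * R)) (I : Type) (s : seq I)
    (F : I -> bipoly R) :
  polygon Omega ->
  intp Omega (\sum_(i <- s) F i) = \sum_(i <- s) intp Omega (F i).
Proof.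
move=> pO; apply: (big_morph (intp Omega)) => [u v|]; first exact: intpD.
by rewrite -(scale0r 0) intpZ// mul0r.
Qed.

(** * Projection for a positive semidefinite form *)

(** The degenerate case of the Cauchy-Schwarz inequality: the form takes at
    [t *: g + f] the value [2 * t * b f g + b f f], an affine function of [t],
    and is nonnegative for all [t] only if [b f g = 0]. *)
Lemma sym_psd_isotropic (R : realFieldType) (V : lmodType R) (b : V -> V -> R)
    (f g : V) :
  (forall u v, b u v = b v u) ->
  (forall a u v w, b (a *: u + v) w = a * b u w + b v w) ->
  (forall u, 0 <= b u u) -> b g g = 0 -> b f g = 0.
Proof.
move=> bC bl b0 gg; apply/eqP/contraT => fg0.
(* The coefficient of [g] is the one that makes the value of the form [-1]. *)
have := b0 (- (b f f + 1) / (2 * b f g) *: g + f).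
rewrite bl [b g _]bC [b f (_ + _)]bC !bl gg [b g f]bC.
rewrite (_ : _ + _ = -1); first by rewrite ler0N1.
by field.
Qed.

(** Membership in the linear span, as membership in every linear subspace that
    contains the family.  This form serves for the degree bound as well as for
    the orthogonality to a fixed vector, both of which define subspaces. *)
Definition in_span (R : pzRingType) (V : lmodType R) (s : seq V) (g : V) : Prop :=
  forall S : set V, S 0 -> (forall a u v, S u -> S v -> S (a *: u + v)) ->
    (forall e, e \in s -> S e) -> S g.

(** Gram-Schmidt.  A new generator [e] is first made orthogonal to the previous
    ones, giving [e - e1]; then a multiple of [e - e1] is added to the
    projection [f1] found so far.  When [e - e1] is isotropic the coefficient of
    that multiple is free, since [e - e1] is then orthogonal to everything. *)
Lemma psd_projection (R : realFieldType) (V : lmodType R) (b : V -> V -> R)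
    (s : seq V) (f : V) :
  (forall u v, b u v = b v u) ->
  (forall a u v w, b (a *: u + v) w = a * b u w + b v w) ->
  (forall u, 0 <= b u u) ->
  exists2 g, in_span s g & forall e, e \in s -> b (f - g) e = 0.
Proof.
move=> bC bl b0.
have bB u v w : b (u - v) w = b u w - b v w.
  by rewrite addrC -scaleN1r bl mulN1r addrC.
have bZ a u w : b (a *: u) w = a * b u w.
  have := bl (a - 1) u u w; rewrite scalerBl scale1r subrK => ->; ring.
have bD u v w : b (u + v) w = b u w + b v w.
  by have := bl 1 u v w; rewrite scale1r mul1r.
elim: s f => [|e s IH] f; first by exists 0.
have [f1 sf1 of1] := IH f; have [e1 se1 oe1] := IH e.
have [tf tP] : exists t, b (f - f1) (e - e1) = t * b (e - e1) (e - e1).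
  have [ee0|ee0] := eqVneq (b (e - e1) (e - e1)) 0.
    by exists 0; rewrite mul0r; exact: sym_psd_isotropic.
  by exists (b (f - f1) (e - e1) / b (e - e1) (e - e1)); rewrite divfK.
exists (tf *: (e - e1) + f1).
  move=> S S0 Sl Ss.
  have Ss' x : x \in s -> S x by move=> xs; apply: Ss; rewrite inE xs orbT.
  apply: (Sl); last exact: (sf1 S S0 Sl Ss').
  rewrite addrC -scaleN1r; apply: (Sl); first exact: (se1 S S0 Sl Ss').
  by apply: Ss; rewrite inE eqxx.
have os x : x \in s -> b (f - (tf *: (e - e1) + f1)) x = 0.
  move=> xs; rewrite opprD addrCA addrC bB bZ.
  by rewrite of1// oe1// mulr0 subr0.
have o1 : b (f - (tf *: (e - e1) + f1)) e1 = 0.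
  apply: (se1 [set x | b (f - (tf *: (e - e1) + f1)) x = 0]) => //=.
  - by rewrite bC -(scale0r 0) bZ mul0r.
  - by move=> a u v ou ov; rewrite bC bl !(bC _ (f - _)) ou ov mulr0 addr0.
move=> x; rewrite inE => /orP[/eqP ->|]; last exact: os.
rewrite -[in X in b _ X](subrK e1 e) bC bD !(bC _ (f - _)) o1 addr0.
by rewrite opprD addrCA addrC bB bZ tP subrr.
Qed.

(** * Polynomials of bounded degree *)

Lemma Pspace_linear (R : realType) (m : nat) (a : R) (u v : bipoly R) :
  Pspace m u -> Pspace m v -> Pspace m (a *: u + v).
Proof.
move=> um vm; apply: (leq_trans (msizeD_le _ _)); rewrite geq_max vm andbT.
exact: leq_trans (msizeZ_le _ _) um.
Qed.

Lemma Pspace0 (R : realType) (m : nat) : @Pspace R m 0.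
Proof. by rewrite /Pspace /= mmeasure0. Qed.

Lemma PspaceC (R : realType) (m : nat) (c : R) : Pspace m (mpolyC 2 c).
Proof. by rewrite /Pspace /= msizeC; case: (c != 0). Qed.

Lemma PspaceD (R : realType) (m : nat) (u v : bipoly R) :
  Pspace m u -> Pspace m v -> Pspace m (u + v).
Proof. by rewrite -{2}(scale1r u); exact: Pspace_linear. Qed.

Lemma PspaceZ (R : realType) (m : nat) (a : R) (u : bipoly R) :
  Pspace m u -> Pspace m (a *: u).
Proof.
by move=> um; rewrite -[_ *: _]addr0; exact: Pspace_linear um (@Pspace0 _ _).
Qed.

Lemma Pspace_le (R : realType) (k m : nat) (u : bipoly R) :
  (k <= m)%N -> Pspace k u -> Pspace m u.
Proof. by move=> km uk; apply: leq_trans uk _; rewrite ltnS. Qed.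

Lemma PspaceX (R : realType) (k : multinom 2) : Pspace (mdeg k) (mpolyX R k).
Proof. by rewrite /Pspace /= msizeX. Qed.

Lemma PspaceM (R : realType) (k m : nat) (u v : bipoly R) :
  Pspace k u -> Pspace m v -> Pspace (k + m) (u * v).
Proof.
rewrite /Pspace /= => uk vm.
have [->|u0] := eqVneq u 0; first by rewrite mul0r mmeasure0.
have [->|v0] := eqVneq v 0; first by rewrite mulr0 mmeasure0.
rewrite msizeM//; apply: (@leq_trans (k.+1 + m.+1).-1); last by rewrite addSn addnS.
by rewrite -!subn1 leq_sub2r// leq_add.
Qed.

Lemma Xvar_Pspace (R : realType) : Pspace 1 (Xvar R).
Proof. by rewrite -(mdeg1 (ord0 : 'I_2)); exact: PspaceX. Qed.

Lemma Yvar_Pspace (R : realType) : Pspace 1 (Yvar R).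
Proof. by rewrite -(mdeg1 (ord_max : 'I_2)); exact: PspaceX. Qed.

Lemma Pspace_monomial_ind (R : realType) (m : nat) (S : set (bipoly R)) :
  S 0 -> (forall a u v, S u -> S v -> S (a *: u + v)) ->
  (forall k : multinom 2, (mdeg k <= m)%N -> S (mpolyX R k)) ->
  Pspace m `<=` S.
Proof.
move=> S0 Sl SX f fm; rewrite (mpolyE f) big_seq_cond.
apply: (big_rec S) => // k g; rewrite andbT => kf Sg; apply: Sl => //.
by apply: SX; rewrite -ltnS; exact: leq_trans (msize_mdeg_lt kf) fm.
Qed.

Lemma mpolyX_factor (R : realType) (k : multinom 2) (i : 'I_2) :
  (0 < k i)%N ->
  exists2 k' : multinom 2, mdeg k = (mdeg k').+1 &
    mpolyX R k = mpolyX R (mnm1 i) * mpolyX R k'.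
Proof.
move=> ki; have ik : lem (mnm1 i) k.
  by apply/mnm_lepP => j; rewrite mnm1E; case: eqP => [<-|].
exists (mnm_sub k (mnm1 i)).
  by rewrite -[in LHS](submK ik) mdegD mdeg1 addn1.
by rewrite mulrC -mpolyXD submK.
Qed.

(** On monomials this is the choice of a variable that divides the monomial;
    the constant monomial supplies [c]. *)
Lemma Pspace_split (R : realType) (m : nat) (f : bipoly R) :
  Pspace m.+1 f -> exists f1 f2 c,
    [/\ Pspace m f1, Pspace m f2 & f = Xvar R * f1 + Yvar R * f2 + mpolyC 2 c].
Proof.
move: f; apply: Pspace_monomial_ind.
- exists 0, 0, 0; split; [exact: Pspace0|exact: Pspace0|].
  by rewrite !mulr0 mpolyC0 !addr0.
- move=> a u v [u1 [u2 [c [u1m u2m ->]]]] [v1 [v2 [d [v1m v2m ->]]]].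
  exists (a *: u1 + v1), (a *: u2 + v2), (a * c + d).
  split; [exact: Pspace_linear|exact: Pspace_linear|].
  rewrite mpolyCD mpolyCM mul_mpolyC -!mul_mpolyC; ring.
- move=> k km; have [k0|k0] := posnP (k ord0); last first.
    have [k' dk ->] := mpolyX_factor R k0.
    exists (mpolyX R k'), 0, 0; split; [|exact: Pspace0|].
      by apply: Pspace_le (PspaceX _ _); rewrite -ltnS -dk.
    by rewrite mulr0 mpolyC0 !addr0.
  have [k1|k1] := posnP (k ord_max); last first.
    have [k' dk ->] := mpolyX_factor R k1.
    exists 0, (mpolyX R k'), 0; split; [exact: Pspace0| |].
      by apply: Pspace_le (PspaceX _ _); rewrite -ltnS -dk.
    by rewrite mulr0 mpolyC0 add0r addr0.
  exists 0, 0, 1; split; [exact: Pspace0|exact: Pspace0|].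
  rewrite !mulr0 !add0r (_ : k = mnm0) ?mpolyX0 ?mpolyC1//.
  apply/mnmP => i; rewrite mnm0E; have := ltn_ord i.
  by case: i => -[|[|//]] i2 _; [rewrite -[RHS]k0|rewrite -[RHS]k1];
    congr (k _); apply/val_inj.
Qed.

(** * Division by orthogonal polynomials *)

(** Subtract from [f] its projection [g] onto the polynomials of degree below
    [m], which are spanned by finitely many monomials.  The difference lies in
    the orthogonal complement, where [B] is a basis. *)
Lemma orthogonal_basis_decomposition (R : realType) (Omega : set (R * R))
    (m : nat) (B : 'I_m.+1 -> bipoly R) (f : bipoly R) :
  polygon Omega -> (1 <= m)%N -> orthogonal_basis Omega B -> Pspace m f ->
  exists (c : 'I_m.+1 -> R) (g : bipoly R),
    Pspace m.-1 g /\ f = \sum_j c j *: B j + g.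
Proof.
move=> pO m1 [_ _ Bspan] fm.
pose s := [seq mpolyX R (bmnm k) | k <- enum {: bmultinom 2 m}].
have sX k : (mdeg k <= m.-1)%N -> mpolyX R k \in s.
  move=> km; have km' : (mdeg k < m)%N by rewrite -(prednK m1) ltnS.
  by apply/mapP; exists (BMultinom km') => //; rewrite mem_enum.
have bl (a : R) (u v w : bipoly R) :
    intp Omega ((a *: u + v) * w) = a * intp Omega (u * w) + intp Omega (v * w).
  by rewrite mulrDl -scalerAl intpD// intpZ.
have bC (u v : bipoly R) : intp Omega (u * v) = intp Omega (v * u).
  by rewrite mulrC.
have [g sg og] := @psd_projection R _ (fun u v => intp Omega (u * v)) s f
  bC bl (intp_sqr_ge0 Omega).
have gm : Pspace m.-1 g.
  apply: sg; [exact: Pspace0|exact: Pspace_linear|].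
  move=> _ /mapP[k _ ->]; apply: Pspace_le (PspaceX _ _).
  by rewrite -ltnS prednK// bmdeg.
have [|c [fgc _]] := Bspan (f - g); last first.
  by exists (c ord0), g; split; rewrite // -fgc subrK.
split.
  rewrite addrC -scaleN1r; apply: Pspace_linear => //.
  by apply: Pspace_le gm; exact: leq_pred.
apply: Pspace_monomial_ind => [|a u v|k /sX]; last exact: og.
  by rewrite mulr0 -(scale0r 0) intpZ// mul0r.
by move=> fu fv; rewrite bC bl !(bC _ (f - g)) fu fv mulr0 addr0.
Qed.

(** Write [f] as [X * f1 + Y * f2 + c0] and replace [f1] and [f2] by
    combinations of the [B j] plus lower order terms.  The terms without a factor
    [B j] now have degree at most [m], so that one more decomposition, with
    constant coefficients, brings the degree below [m]. *)
Lemma division_step (R : realType) (Omega : set (R * R)) (m : nat)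
    (B : 'I_m.+1 -> bipoly R) (f : bipoly R) :
  polygon Omega -> (1 <= m)%N -> orthogonal_basis Omega B -> Pspace m.+1 f ->
  exists (q : 'I_m.+1 -> bipoly R) (g : bipoly R),
    [/\ forall j, Pspace 1 (q j), Pspace m.-1 g & f = \sum_j q j * B j + g].
Proof.
move=> pO m1 oB /Pspace_split[f1 [f2 [c0 [f1m f2m ->]]]].
have [a [g1 [g1m ->]]] := orthogonal_basis_decomposition pO m1 oB f1m.
have [b [g2 [g2m ->]]] := orthogonal_basis_decomposition pO m1 oB f2m.
have hm : Pspace m (Xvar R * g1 + Yvar R * g2 + mpolyC 2 c0).
  apply: PspaceD (PspaceC _ _); rewrite -(prednK m1) -add1n.
  by apply: PspaceD; apply: PspaceM => //; [exact: Xvar_Pspace|exact: Yvar_Pspace].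
have [c [g [gm hE]]] := orthogonal_basis_decomposition pO m1 oB hm.
exists (fun j => a j *: Xvar R + b j *: Yvar R + mpolyC 2 (c j)), g.
split=> // [j|].
  apply: PspaceD (PspaceC _ _); apply: Pspace_linear; first exact: Xvar_Pspace.
  by apply: PspaceZ; exact: Yvar_Pspace.
rewrite !mulrDr.
transitivity (Xvar R * (\sum_j a j *: B j) + Yvar R * (\sum_j b j *: B j) +
   (Xvar R * g1 + Yvar R * g2 + mpolyC 2 c0)); first by ring.
rewrite hE addrA !mulr_sumr -!big_split /=; congr (_ + _).
by apply: eq_bigr => j _; rewrite -!mul_mpolyC; ring.
Qed.

Lemma odd_expansion_exists (R : realType) (Omega : set (R * R))
    (P : forall m : nat, 'I_m.+1 -> bipoly R) (d : nat) (f : bipoly R) :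
  polygon Omega ->
  (forall m : nat, (1 <= m)%N -> orthogonal_basis Omega (P m)) ->
  Pspace d.*2 f ->
  exists (q : forall k : nat, 'I_(k.*2.+1).+1 -> bipoly R) (r : R),
    odd_expansion P d f q r.
Proof.
move=> pO oP.
(* Quotients indexed by plain numbers can be redefined at [k = d] without a
   cast between the types ['I_(k.*2.+1).+1] and ['I_(d.*2.+1).+1]. *)
suff H : Pspace d.*2 f -> exists (q : nat -> nat -> bipoly R) (r : R),
    odd_expansion P d f (fun k j => q k j) r.
  by move=> /H[q [r qr]]; exists (fun k j => q k j), r.
elim: d f => [|d IH] f fd.
  exists (fun _ _ => 0), (mcoeff mnm0 f); split=> //.
  by rewrite big_ord0 add0r; exact: msize1_polyC.
have [Q [g [Q1 gd fE]]] :=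
  division_step pO (ltn0Sn d.*2) (oP _ (ltn0Sn d.*2)) fd.
have [q [r [q1 gE]]] := IH g gd.
exists (fun k j => if k == d then Q (inord j) else q k j), r; split.
  move=> k j; rewrite ltnS leq_eqVlt; case: eqP => [_ _|_ /= kd]; first exact: Q1.
  exact: q1.
rewrite big_ord_recr /= eqxx {1}fE {1}gE addrA; congr (_ + _); rewrite addrC.
congr (_ + _).
  apply: eq_bigr => k _; apply: eq_bigr => j _.
  by rewrite ltn_eqF.
by apply: eq_bigr => j _; rewrite inord_val.
Qed.

(** * Integration of the expansion *)

(** For [k >= 1] the quotient [q k j] is linear, hence of degree at most
    [k.*2], to which [P k.*2.+1 j] is orthogonal: only [k = 0] survives. *)
Lemma intp_odd_expansion (R : realType) (Omega : set (R * R))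
    (P : forall m : nat, 'I_m.+1 -> bipoly R) (d : nat) (f : bipoly R)
    (q : forall k : nat, 'I_(k.*2.+1).+1 -> bipoly R) (r : R) :
  polygon Omega ->
  (forall m : nat, (1 <= m)%N -> orthogonal_basis Omega (P m)) ->
  (1 <= d)%N -> odd_expansion P d f q r ->
  intp Omega f = \sum_(j < 2) intp Omega (q 0%N j * P 1%N j) + r * area Omega.
Proof.
move=> pO oP; case: d => // d _ [q1 ->].
rewrite intpD// intpC// intp_sum// big_ord_recl /= intp_sum//.
rewrite [X in _ + X + _]big1 ?addr0// => k _; rewrite intp_sum// big1// => j _.
have [/(_ j)[_ oPj] _ _] := oP (bump 0 k).*2.+1 isT.
rewrite mulrC; apply: oPj => /=; apply: Pspace_le (q1 _ j _) => //.
by rewrite /bump /= !add1n ltnS.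
Qed.

Lemma peval_odd_expansion (R : realType)
    (P : forall m : nat, 'I_m.+1 -> bipoly R) (p : R * R) (d : nat)
    (f : bipoly R) (q : forall k : nat, 'I_(k.*2.+1).+1 -> bipoly R) (r : R) :
  (forall (k : nat) (j : 'I_(k.*2.+1).+1), peval (P k.*2.+1 j) p = 0) ->
  odd_expansion P d f q r -> peval f p = r.
Proof.
move=> Pp [_ ->].
rewrite /peval mevalD mevalC (raddf_sum (meval _)) big1 ?add0r//= => k _.
rewrite (raddf_sum (meval _)) big1//= => j _.
by rewrite mevalM [X in _ * X]Pp mulr0.
Qed.

Theorem theorem4p6 (R : realType) (Omega : set (R * R))
    (P : forall m : nat, 'I_m.+1 -> bipoly R) (p : R * R) :
  polygon Omega ->
  (forall m : nat, (1 <= m)%N -> orthogonal_basis Omega (P m)) ->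
  Omega p ->
  (forall (k : nat) (j : 'I_(k.*2.+1).+1), peval (P k.*2.+1 j) p = 0) ->
  forall (d n : nat) (Pn : bipoly R),
    (1 <= d)%N -> (2 * d - 1 <= n <= 2 * d)%N ->
    mmeasure mdeg Pn = n.+1 ->
    (exists (q : forall k : nat, 'I_(k.*2.+1).+1 -> bipoly R) (r : R),
        odd_expansion P d Pn q r) /\
    (forall (q : forall k : nat, 'I_(k.*2.+1).+1 -> bipoly R) (r : R),
      odd_expansion P d Pn q r ->
      ((forall j : 'I_2, exists c : R, q 0%N j = mpolyC 2 c) ->
        intp Omega Pn = peval Pn p * area Omega) /\
      (forall a b c : 'I_2 -> R,
        (forall j : 'I_2,
           q 0%N j = a j *: Xvar R + b j *: Yvar R + mpolyC 2 (c j)) ->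
        intp Omega Pn = peval Pn p * area Omega
          + \sum_(j < 2) (a j * intp Omega (Xvar R * P 1%N j)
                          + b j * intp Omega (Yvar R * P 1%N j)))).
Proof.
move=> pO oP _ Pp d n Pn d1 /andP[_ nd] sPn; split.
  apply: (odd_expansion_exists pO oP).
  by rewrite /Pspace /= sPn ltnS -mul2n.
move=> q r qr; rewrite (intp_odd_expansion pO oP d1 qr).
rewrite (peval_odd_expansion Pp qr).
have o1 (c : R) (j : 'I_2) : intp Omega (mpolyC 2 c * P 1%N j) = 0.
  have [/(_ j)[_ oPj] _ _] := oP 1%N isT.
  by rewrite mulrC; apply: oPj; exact: PspaceC.
split=> [qc|a b c qE].
  by rewrite big1 ?add0r// => j _; have [c ->] := qc j.
rewrite addrC; congr (_ + _); apply: eq_bigr => j _.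
by rewrite qE !mulrDl -!scalerAl !intpD// !intpZ// o1 addr0.
Qed.
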